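(* Let $(X_i)_{i\ge 1}$ be the Markov chain $X_n=F(X_{n-1},\varepsilon_n)$, $n\ge 2$, where $F$ satisfies, for some $\rho\in[0,1)$, $\mathbb E[d(F(x,\varepsilon_1),F(x',\varepsilon_1))]\le \rho\, d(x,x')$ for all $x,x'\in\mathcal X$. Let $f$, $g_k$, $d_k$, $K_k(\rho)$ be as defined in the context. Then: 1. For each $k\in[1,n]$, the function $g_k$ is separately Lipschitz and such that, for all $x_i,x_i'\in\mathcal X$, $$|g_k(x_1,\ldots,x_k)-g_k(x_1',\ldots,x_k')|\le d(x_1,x_1')+\cdots+d(x_{k-1},x_{k-1}')+K_{n-k}(\rho)\,d(x_k,x_k').$$ 2. Let $P_{X_1}$ be the distribution of $X_1$ and $P_\varepsilon$ the common distribution of the $\varepsilon_k$'s, and let $$G_{X_1}(x)=\int d(x,x')\,P_{X_1}(dx'),\qquad H_\varepsilon(x,y)=\int d(F(x,y),F(x,y'))\,P_\varepsilon(dy').$$ Then (almost surely) $|d_1|\le K_{n-1}(\rho)\,G_{X_1}(X_1)$ and, for $k\in[2,n]$, $|d_k|\le K_{n-k}(\rho)\,H_\varepsilon(X_{k-1},\varepsilon_k)$. 3. Assume moreover that, for some $C>0$, $d(F(x,y),F(x,y'))\le C\,\delta(y,y')$ for all $x\in\mathcal X$, $y,y'\in\mathcal Y$, and let $G_\varepsilon(y)=\int C\,\delta(y,y')\,P_\varepsilon(dy')$. Then $H_\varepsilon(x,y)\le G_\varepsilon(y)$, and consequently, for $k\in[2,n]$, $|d_k|\le K_{n-k}(\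rho)\,G_\varepsilon(\varepsilon_k)$.
   Context: $(\mathcal X,d)$ and $(\mathcal Y,\delta)$ are complete separable metric spaces; $(\varepsilon_i)_{i\ge1}$ is a sequence of iid $\mathcal Y$-valued random variables; $X_1$ is an $\mathcal X$-valued random variable independent of $(\varepsilon_i)_{i\ge2}$; $F:\mathcal X\times\mathcal Y\to\mathcal X$ is measurable. For $k\in\mathbb N$, $K_k(\rho)=(1-\rho^{k+1})/(1-\rho)=1+\rho+\cdots+\rho^k$. Fix $n\ge1$ and $f:\mathcal X^n\to\mathbb R$ with $|f(x_1,\ldots,x_n)-f(x_1',\ldots,x_n')|\le d(x_1,x_1')+\cdots+d(x_n,x_n')$ for all arguments, and such that $f(X_1,\ldots,X_n)$ is integrable. Let $\mathcal F_0=\{\emptyset,\Omega\}$ and $\mathcal F_k=\sigma(X_1,\ldots,X_k)$. The functions $g_k$ are defined by $g_k(X_1,\ldots,X_k)=\mathbb E[f(X_1,\ldots,X_n)\mid\mathcal F_k]$, using the version given by $g_n=f$ and $g_{k-1}(x_1,\ldots,x_{k-1})=\int g_k(x_1,\ldots,x_{k-1},F(x_{k-1},y))\,P_\varepsilon(dy)$ for $k\in[2,n]$; the constant $g_0$ is $\mathbb E[f(X_1,\ldots,X_n)]$. The martingale differences are $d_k=g_k(X_1,\ldots,X_k)-g_{k-1}(X_1,\ldots,X_{k-1})$, $k\in[1,n]$. *)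

(* Defs.v *)
From HB Require Import structures.
From mathcomp Require Import all_boot all_order all_algebra.
From mathcomp Require Import finmap.
From mathcomp Require Import all_classical all_reals all_analysis.

Set Implicit Arguments.
Unset Strict Implicit.
Unset Printing Implicit Defensive.

Import Order.TTheory GRing.Theory Num.Theory.
Import numFieldNormedType.Exports.

Local Open Scope classical_set_scope.
Local Open Scope ring_scope.

(* Nonempty complete metric spaces: the library attaches generated
   sigma-algebras to pointed types only. *)
#[short(type="completePMetricType")]
HB.structure Definition CompletePMetric (R : numDomainType) :=
  {M of Metric R M & Complete M & isPointed M}.

Definition separable (T : topologicalType) :=
  exists2 D : set T, countable D & dense D.

Notation borel T := (g_sigma_algebraType (@open T)).

Section probability_notions.
Context (d d' : measure_display) (Om : measurableType d)
  (S : measurableType d') (R : realType) (P : probability Om R).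

Definition sigma_family (I : set nat) (Y : nat -> {RV P >-> S}) :
    set (set Om) :=
  <<s \bigcup_(i in I) g_sigma_algebra_preimage (Y i) >>.

Definition mutually_independent (I : set nat) (Y : nat -> {RV P >-> S}) :=
  forall (J : {fset nat}) (B : nat -> set S),
    [set` J] `<=` I -> (forall i, i \in J -> measurable (B i)) ->
    P (\bigcap_(i in [set` J]) Y i @^-1` B i) =
    (\prod_(i <- J) P (Y i @^-1` B i))%E.

Definition identically_distributed (I : set nat) (Y : nat -> {RV P >-> S}) :=
  forall i j, I i -> I j -> forall B, measurable B ->
    distribution P (Y i) B = distribution P (Y j) B.

Definition iid (I : set nat) (Y : nat -> {RV P >-> S}) :=
  mutually_independent I Y /\ identically_distributed I Y.

Definition independent_systems (G H : set (set Om)) :=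
  forall A B, G A -> H B -> P (A `&` B) = (P A * P B)%E.

(* V is a version of the conditional expectation of U given the
   sigma-algebra G. *)
Definition is_cond_exp (G : set (set Om)) (U V : Om -> R) :=
  [/\ forall B : set R, measurable B -> G (V @^-1` B),
      P.-integrable setT (EFin \o V) &
      forall A, G A ->
        (\int[P]_(w in A) (V w)%:E = \int[P]_(w in A) (U w)%:E)%E].

End probability_notions.

(* The trajectory X_1, ..., X_k: X is indexed from 1 and X 0 is never used,
   while tuple positions start from 0. *)
Definition traj (Om T : Type) (X : nat -> Om -> T) (k : nat) (w : Om) :
  k.-tuple T := [tuple X i.+1 w | i < k].

Definition separately_lipschitz (R : realType) (M : metricType R) (k : nat)
    (h : k.-tuple M -> R) :=
  forall i : 'I_k, exists c : R, forall x x' : k.-tuple M,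
    (forall j, j != i -> tnth x j = tnth x' j) ->
    `|h x - h x'| <= c * mdist (tnth x i) (tnth x' i).

Definition Kfun (R : realType) (rho : R) (k : nat) : R :=
  (1 - rho ^+ k.+1) / (1 - rho).

Section chain.
Context (R : realType) (d : measure_display) (Om : measurableType d)
  (P : probability Om R) (M N : completePMetricType R).
Implicit Types (X : nat -> {RV P >-> borel M}) (F : M -> N -> M).

(* g 0 is E[f(X_1, ..., X_n)], g n is f, and g k is obtained from g k.+1 by
   integrating out its last variable; g k is left free for k > n. *)
Definition backward_version X (eps : nat -> {RV P >-> borel N}) F (n : nat)
    (f : n.-tuple M -> R) (g : forall k, k.-tuple M -> R) :=
  [/\ g n = f,
      forall k (x : k.+1.-tuple M), (k.+1 < n)%N ->
        g k.+1 x = \int[distribution P (eps 1%N)]_y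
          g k.+2 [tuple of rcons x (F (tnth x ord_max) y)] &
      forall x : 0.-tuple M, g 0%N x = fine 'E_P[f \o traj X n]].

Definition mart_diff X (g : forall k, k.-tuple M -> R) (k : nat) (w : Om) : R :=
  g k (traj X k w) - g k.-1 (traj X k.-1 w).

Definition G_X1 (X1 : {RV P >-> borel M}) (x : M) : \bar R :=
  (\int[distribution P X1]_x' (mdist x (x' : M))%:E)%E.

Definition H_eps (eps1 : {RV P >-> borel N}) F (x : M) (y : N) : \bar R :=
  (\int[distribution P eps1]_y' (mdist (F x y) (F x y'))%:E)%E.

Definition G_eps (eps1 : {RV P >-> borel N}) (C : R) (y : N) : \bar R :=
  (\int[distribution P eps1]_y' (C * mdist y (y' : N))%:E)%E.

End chain.

(* Main.v *)
Require Import Defs.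
From HB Require Import structures.
From mathcomp Require Import all_boot all_order all_algebra.
From mathcomp Require Import finmap.
From mathcomp Require Import all_classical all_reals all_analysis.
From mathcomp Require Import measurable_realfun zify ring lra.

Set Implicit Arguments.
Unset Strict Implicit.
Unset Printing Implicit Defensive.

Import Order.TTheory GRing.Theory Num.Theory.
Import numFieldNormedType.Exports.

Local Open Scope classical_set_scope.
Local Open Scope ring_scope.

(** The bounds come from integrating out one innovation at a time, starting
    from [f].  Suppose [h] is a function of [k.+2] variables that is Lipschitz
    with constant [1] in each variable except the last, where the constant is
    [c].  Substitute [F x y] for the last variable, [x] being the one before,
    and average over [y]: by the contraction property the last difference
    contributes at most [rho * c] times the distance between the former [x]
    and the new one, which adds to the [1] that this variable had already.
    So the new constant is [1 + rho * c] (lemma [integrate_last_lip]), and the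
    recursion [Kfun rho k.+1 = 1 + rho * Kfun rho k] gives part 1.

    That the averaged functions are versions of the conditional expectation is
    Fubini's theorem: the past, that is the sigma-algebra of [X 1, ..., X k],
    is independent of the innovation [eps k.+1] ([indep_past_innovation]), so
    the joint law of the identity, viewed as a map into the space carrying the
    past sigma-algebra, and of [eps k.+1] is a product measure
    ([integral_freezing]).

    The two arguments depend on each other.  The real-valued integral defining
    [g k] means what it should only if the integrand is integrable for every
    argument, and no moment of [mdist (F x y) x0] is assumed finite.  Fubini's
    theorem, applied to the integrable variable [g k.+1 (X 1, ..., X k.+1)],
    provides one good argument, and the Lipschitz bound together with the
    contraction property transports integrability from that argument to all
    the others ([integrable_extend]).  Hence Lipschitz bounds and conditional
    expectations are established together, by backward induction.

    For parts 2 and 3, [g k.-1] is the average of [g k] over an independent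
    copy of the last innovation, or of [X 1] if [k = 1].  So a martingale
    difference is the average of a difference between two values of [g k] whose
    arguments differ only in the last place, and the Lipschitz bound in that
    place gives estimates that hold at every point. *)

(** * Measurability on separable metric spaces *)

Lemma measurable_mdist_ball (R : realType) (M : completePMetricType R)
  (x : M) (r : R) : measurable ([set y | mdist y x < r] : set (borel M)).
Proof.
apply: sub_sigma_algebra => /=; rewrite openE => y /= yxr.
rewrite /interior nbhs_ballP; exists (r - mdist y x) => /=.
  by rewrite subr_gt0.
move=> z; rewrite ballEmdist/= metric_sym => zy.
by rewrite (le_lt_trans (metric_triangle z y x))// -ltrBrDr.
Qed.

Lemma separable_dense_seq (R : realType) (M : completePMetricType R) :
  separable M ->
  exists q : nat -> M, forall x e, 0 < e -> exists n, mdist x (q n) < e.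
Proof.
case=> D /countable_injP[f finj] dD.
pose q n : M := xget point [set y | D y /\ f y = n].
exists q => x e e0.
have [||y [xey Dy]] := dD (interior (ball x e)).
- by exists x; exact: nbhsx_ballx.
- exact: open_interior.
exists (f y); suff -> : q (f y) = y.
  by move/interior_subset: xey; rewrite ballEmdist.
rewrite /q; case: xgetP => [z _ [Dz fzy]|/(_ y)/=]; last by case.
by apply: finj => //; rewrite inE.
Qed.

(** Only the coordinates of [U] are assumed measurable for the Borel
    sigma-algebra of [M].  Separability makes up for the lack of a topology on
    tuples: [h (U w) < r] exactly when [U w] lies, coordinatewise, within some
    radius [s m] of a tuple of points of a dense sequence at which [h] is
    smaller than [r] by more than the variation allowed for [h] at that radius.  There
    are countably many such products. *)
Lemma measurable_lipschitz_tuple (R : realType) (M : completePMetricType R)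
  (sepM : separable M) (d : measure_display) (T : measurableType d) (k : nat)
  (h : k.-tuple M -> R) (c : R) (U : T -> k.-tuple M) :
  0 <= c ->
  (forall x x', `|h x - h x'| <=
     c * \sum_(i < k) mdist (tnth x i) (tnth x' i)) ->
  (forall i : 'I_k,
     measurable_fun setT (fun w => tnth (U w) i : borel M)) ->
  measurable_fun setT (h \o U).
Proof.
move=> c0 hlip mU; have [q qdense] := separable_dense_seq sepM.
apply: (measurability _ (RGenInftyO.measurableE R)) => //.
move=> _ [_ [r ->] <-]; rewrite setTI.
have sum_le (x x' : k.-tuple M) e :
    (forall i, mdist (tnth x i) (tnth x' i) <= e) ->
    \sum_(i < k) mdist (tnth x i) (tnth x' i) <= e *+ k.
  by move=> xe; rewrite -[in leRHS](card_ord k) -sumr_const ler_sum.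
pose ctr (a : k.-tuple nat) : k.-tuple M := [tuple q (tnth a i) | i < k].
have [s [s0 ss]] : exists s : nat -> R,
    (forall m, 0 < s m) /\ forall e, 0 < e -> exists m, s m < e.
  exists (fun m => m.+1%:R^-1); split => // e e0.
  by have [m] := ltr_add_invr e0; rewrite add0r; exists m.
pose cell (p : k.-tuple nat * nat) : set T :=
  if h (ctr p.1) + c * (s p.2 *+ k) < r then
    \big[setI/setT]_(i < k)
      [set w | mdist (tnth (U w) i) (q (tnth p.1 i)) < s p.2]
  else set0.
suff -> : (h \o U) @^-1` `]-oo, r[ = \bigcup_p cell p.
  apply: countable_bigcupT_measurable => // p; rewrite /cell.
  case: ifPn => // _; apply: bigsetI_measurable => i _.
  rewrite -[X in measurable X]setTI.
  exact: (mU i measurableT _ (measurable_mdist_ball _ _)).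
apply/seteqP; split => [w /=|w [p _]].
- rewrite in_itv/= => hr.
  have [m mP] : exists m, c * (s m *+ k) < (r - h (U w)) / 2.
    (* The variation at radius [s m] is paid twice, for passing from [U w] to
       the centre and in the definition of [cell]: hence the factor [2]. *)
    have e0 : 0 < (r - h (U w)) / 2 by rewrite divr_gt0// subr_gt0.
    have ck0 : 0 < c * k%:R + 1 by rewrite ltr_wpDl// mulr_ge0.
    have [m sm] := ss _ (divr_gt0 e0 ck0); exists m.
    have -> : c * (s m *+ k) = s m * (c * k%:R) by rewrite mulrCA mulr_natr.
    move: sm; rewrite ltr_pdivlMr// mulrDr mulr1; apply: le_lt_trans.
    by rewrite lerDl ltW.
  have /choice[a aP] (i : 'I_k) : exists j, mdist (tnth (U w) i) (q j) < s m.
    exact: qdense.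
  exists ([tuple a i | i < k], m) => //; rewrite /cell /= ifT.
    rewrite big_mkcond/=; elim/big_ind : _ => //= i _.
    by rewrite tnth_mktuple.
  have hd : h (ctr [tuple a i | i < k]) - h (U w) <= c * (s m *+ k).
    rewrite (le_trans (ler_norm _))// distrC (le_trans (hlip _ _))//.
    by rewrite ler_wpM2l// sum_le// => i; rewrite !tnth_mktuple ltW.
  lra.
- rewrite /cell; case: ifPn => // hr.
  rewrite -bigcap_seq /= => wp; rewrite in_itv /=.
  rewrite (le_lt_trans _ hr)// -lerBlDl (le_trans (ler_norm _))//.
  rewrite (le_trans (hlip _ _))// ler_wpM2l// sum_le// => i.
  by rewrite tnth_mktuple ltW// (wp i)//= mem_index_enum.
Qed.

(** * Integrating out an independent variable *)

Lemma ae_ex (d : measure_display) (T : measurableType d) (R : realType)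
  (mu : probability T R) (Q : T -> Prop) :
  {ae mu, forall x, Q x} -> exists x, Q x.
Proof.
case=> A [mA A0 QA]; apply: contrapT => /forallNP nQ.
have AT : A = setT by apply/seteqP; split => // x _; apply: QA => /=; apply: nQ.
by move: A0; rewrite AT probability_setT => /eqP; rewrite eqe oner_eq0.
Qed.

Lemma abs_Rintegral_sub_le (d : measure_display) (T : measurableType d)
  (R : realType) (mu : {measure set T -> \bar R}) (u v c : T -> R) :
  mu.-integrable setT (EFin \o u) -> mu.-integrable setT (EFin \o v) ->
  measurable_fun setT c -> (forall y, `|u y - v y| <= c y) ->
  (`| \int[mu]_y u y - \int[mu]_y v y |%:E <= \int[mu]_y (c y)%:E)%E.
Proof.
move=> iu iv mc uvc; rewrite -RintegralB//.
have iuv : mu.-integrable setT (EFin \o (u \- v)).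
  by apply: eq_integrable (integrableB _ iu iv).
rewrite EFin_normr_Rintegral//.
apply: le_trans (le_abse_integral _ _ _) _ => //.
  exact: measurable_int iuv.
apply: ge0_le_integral => //.
- exact: measurable_int (integrable_abse iuv).
- exact/measurable_EFinP.
- by move=> y _; rewrite abse_EFin lee_fin.
Qed.

Lemma abs_sub_Rintegral_le (d : measure_display) (T : measurableType d)
  (R : realType) (mu : probability T R) (a b : R) (v c : T -> R) :
  0 <= b -> (forall y, 0 <= c y) ->
  mu.-integrable setT (EFin \o v) -> measurable_fun setT c ->
  (forall y, `|a - v y| <= b * c y) ->
  (`| a - \int[mu]_y v y |%:E <= b%:E * \int[mu]_y (c y)%:E)%E.
Proof.
move=> b0 c0 iv mc avc.
have aE : a = \int[mu]_y cst a y.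
  by rewrite Rintegral_cst// [X in fine X](probability_setT mu) mulr1.
rewrite [in leLHS]aE -ge0_integralZl_EFin//; first last.
- exact/measurable_EFinP.
- by move=> y _; rewrite lee_fin.
under [in leRHS]eq_integral do rewrite -EFinM.
apply: abs_Rintegral_sub_le => //.
- exact: finite_measure_integrable_cst.
- exact: measurable_funM.
Qed.

Section freezing.
Context (R : realType) (d d1 d2 : measure_display) (T : measurableType d)
  (T1 : measurableType d1) (T2 : measurableType d2) (P : probability T R)
  (m2 : probability T2 R) (U : T -> T1) (V : T -> T2) (phi : T1 * T2 -> R).
Hypotheses (mU : measurable_fun setT U) (mV : measurable_fun setT V).
Hypothesis UV : forall A B, measurable A -> measurable B ->
  P (U @^-1` A `&` V @^-1` B) = (P (U @^-1` A) * m2 B)%E.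
Hypothesis mphi : measurable_fun setT phi.
Hypothesis iphi : P.-integrable setT (fun w => (phi (U w, V w))%:E).

Let U' : {mfun T >-> T1} := HB.pack U (isMeasurableFun.Build _ _ _ _ _ mU).
Let UV' : {mfun T >-> (T1 * T2)%type} :=
  HB.pack (fun w => (U w, V w))
    (isMeasurableFun.Build _ _ _ _ _ (measurable_fun_pair mU mV)).
Let m1 : probability T1 R := distribution P U'.

(** The uniqueness of product measures: the hypothesis [UV] says that the joint
    law of [(U, V)] agrees with the product measure on rectangles. *)
Let lawE (X : set (T1 * T2)) :
  measurable X -> (m1 \x m2)%E X = distribution P UV' X.
Proof. by apply: product_measure_unique => A B mA mB; rewrite -UV. Qed.

Let Ephi (x : T1 * T2) := (phi x)%:E.

Let mEphi : measurable_fun setT Ephi.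
Proof. exact/measurable_EFinP. Qed.

Let integrable_prod : (m1 \x m2)%E.-integrable setT Ephi.
Proof.
have : (distribution P UV').-integrable setT Ephi.
  exact: integrable_pushforward.
move=> /integrableP[mp fin]; apply/integrableP; split => //.
rewrite (eq_measure_integral (distribution P UV'))// => A mA _.
exact: lawE.
Qed.

(** Sections of an integrable function are integrable almost everywhere, hence
    somewhere, the law of [U] being a probability. *)
Lemma ex_integrable_section :
  exists u, m2.-integrable setT (fun v => (phi (u, v))%:E).
Proof. by have := ae_integrable1 integrable_prod; apply: ae_ex. Qed.

Lemma integrable_freezing :
  P.-integrable setT (fun w => \int[m2]_v (phi (U w, v))%:E)%E.
Proof.
have := integrable_fubini_F integrable_prod.
move=> /integrableP[mF iF]; apply/integrableP; split.
  exact: measurableT_comp mF mU.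
move: iF; rewrite ge0_integral_pushforward//.
exact: measurableT_comp.
Qed.

Lemma measurable_freezing :
  measurable_fun setT (fun u => \int[m2]_v (phi (u, v))%:E)%E.
Proof. exact: measurable_fubini_F integrable_prod. Qed.

(** This says that [E[phi(U, V) | U]] is obtained by freezing [U] and averaging
    over [V].  Restricting to [U @^-1` A] amounts to multiplying [phi] by the
    indicator of the strip [A `*` setT], to which Fubini's theorem applies. *)
Lemma integral_freezing (A : set T1) : measurable A ->
  (\int[P]_(w in U @^-1` A) (\int[m2]_v (phi (U w, v))%:E) =
   \int[P]_(w in U @^-1` A) (phi (U w, V w))%:E)%E.
Proof.
move=> mA.
have mAT : measurable (A `*` [set: T2]) by exact: measurableX.
transitivity (\int[P]_(w in UV' @^-1` (A `*` [set: T2])) (Ephi \o UV') w)%E;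
  last first.
  by congr (integral _ _ _); apply/seteqP; split => w //= [].
have mUVA : measurable (UV' @^-1` (A `*` [set: T2])).
  exact: measurable_funPTI.
have mUA : measurable (U' @^-1` A) by exact: measurable_funPTI.
rewrite -integral_pushforward//; last first.
  by apply: integrableS iphi.
transitivity (\int[(m1 \x m2)%E]_(x in A `*` [set: T2]) Ephi x)%E; last first.
  by apply: eq_measure_integral => B mB _; exact: lawE.
have := @integral12_prod_meas1 _ _ _ _ _ m1 m2 (Ephi \_ (A `*` setT)).
rewrite -integral_mkcond => <-; last first.
  apply/(integrable_mkcond _ mAT).
  by apply: integrableS integrable_prod.
transitivity (\int[m1]_(u in A) fubini_F m2 Ephi u)%E.
  rewrite integral_pushforward//.
    exact: measurable_freezing.
  by apply: integrableS integrable_freezing.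
rewrite integral_mkcond; apply: eq_integral => u _; rewrite /fubini_F patchE.
case: ifPn => uA; apply/esym.
  apply: eq_integral => v _; rewrite patchE ifT// inE/=; split => //.
  by rewrite inE in uA.
apply: integral0_eq => v _; rewrite patchE ifF//; apply/negP => /[!inE] -[/=].
by rewrite notin_setE in uA.
Qed.

End freezing.

(** * Independence of the past and the next innovation *)

(** The variables [X 1, ..., X k] are functions of [X 1, eps 2, ..., eps k], so
    the past is contained in the sigma-algebra generated by the cylinders
    defined by these.  Cylinders are stable under intersection, so by the
    uniqueness of finite measures on a pi-system it is enough to check the
    product formula for them; it follows from the independence of [X 1] and the
    innovations, used once with [eps k.+1] and once without. *)
Lemma indep_past_innovation (R : realType) (M N : completePMetricType R)
  (d : measure_display) (Om : measurableType d) (P : probability Om R)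
  (eps : nat -> {RV P >-> borel N}) (X : nat -> {RV P >-> borel M})
  (F : M -> N -> M)
  (eps_indep : mutually_independent [set i | (1 <= i)%N] eps)
  (X1_eps : independent_systems P (g_sigma_algebra_preimage (X 1%N))
     (sigma_family [set i | (2 <= i)%N] eps))
  (mF : measurable_fun setT
     (fun p : borel M * borel N => F p.1 p.2 : borel M))
  (chain : forall i w, (2 <= i)%N -> X i w = F (X i.-1 w) (eps i w))
  (k : nat) (A : set Om) (B : set (borel N)) :
  (1 <= k)%N -> sigma_family [set i | (1 <= i <= k)%N] X A -> measurable B ->
  P (A `&` eps k.+1 @^-1` B) = (P A * P (eps k.+1 @^-1` B))%E.
Proof.
move=> k1 sA mB.
pose cyl (B1 : set (borel M)) (C : nat -> set (borel N)) : set Om :=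
  X 1%N @^-1` B1 `&`
  \bigcap_(i in [set i | (2 <= i <= k)%N]) eps i @^-1` C i.
pose Pi : set (set Om) := [set D | exists B1 C,
  [/\ measurable B1, forall i, measurable (C i) & D = cyl B1 C]].
have mX i (C : set (borel M)) : measurable C -> measurable (X i @^-1` C).
  exact: measurable_funPTI.
have meps i (C : set (borel N)) : measurable C -> measurable (eps i @^-1` C).
  exact: measurable_funPTI.
have mcyl B1 C : measurable B1 -> (forall i, measurable (C i)) ->
    measurable (cyl B1 C).
  move=> mB1 mC; apply: measurableI; first exact: mX.
  by apply: bigcap_measurableType => i _; exact: meps.
have PiT : Pi setT.
  exists setT, (fun=> setT); split => //.
  by apply/seteqP; split => // w _; split.
have PiI : setI_closed Pi.
  move=> _ _ [B1 [C [mB1 mC ->]]] [B1' [C' [mB1' mC' ->]]].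
  exists (B1 `&` B1'), (fun i => C i `&` C' i); split.
  - exact: measurableI.
  - by move=> i; exact: measurableI.
  - apply/seteqP; split => w.
    + move=> [[? Cw] [? C'w]]; split => // i ik.
      by split; [exact: Cw|exact: C'w].
    + by move=> [[? ?] CC']; split; split => // i /CC'[].
have PiX1 : measurable_fun setT (X 1%N : g_sigma_algebraType Pi -> borel M).
  move=> _ C mC; rewrite setTI; apply: sub_sigma_algebra.
  exists C, (fun=> setT); split => //.
  by apply/seteqP; split => [w ?|w []//]; split.
have Pieps i : (2 <= i <= k)%N ->
    measurable_fun setT (eps i : g_sigma_algebraType Pi -> borel N).
  move=> ik _ C mC; rewrite setTI; apply: sub_sigma_algebra.
  exists setT, (fun j => if j == i then C else setT); split => //.
    by move=> j; case: ifPn.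
  apply/seteqP; split => [w Cw|w [_ /(_ i ik)/=]]; last by rewrite eqxx.
  by split => // j jk /=; case: ifPn => // /eqP ->.
have sfam S : (forall i, S i -> (2 <= i)%N) ->
    forall C, (forall i, measurable (C i)) ->
    sigma_family [set i | (2 <= i)%N] eps (\bigcap_(i in S) eps i @^-1` C i).
  move=> S2 C mC.
  apply: (@bigcap_measurableType _ (g_sigma_algebraType _)) => i /S2 i2.
  apply: sub_sigma_algebra; exists i => //.
  by exists (C i) => //; rewrite setTI.
have PiX i : (1 <= i <= k)%N ->
    measurable_fun setT (X i : g_sigma_algebraType Pi -> borel M).
  elim: i => // -[//|i] ih /andP[_ ik].
  have -> : (X i.+2 : Om -> M) = (fun p => F p.1 p.2) \o
      (fun w => (X i.+1 w, eps i.+2 w)).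
    by apply/funext => w /=; rewrite chain.
  apply: measurableT_comp => //; apply: measurable_fun_pair.
    by apply: ih; rewrite /= ltnW.
  exact: Pieps.
have sAPi : <<s Pi >> A.
  move: A sA; apply: smallest_sub; first exact: smallest_sigma_algebra.
  move=> _ [i /= ik [C mC <-]]; exact: (PiX i ik measurableT).
pose E := eps k.+1 @^-1` B.
have mE : measurable E by exact: meps.
have PE0 : 0 <= fine (P E) by rewrite fine_ge0.
rewrite muleC -[P (eps _ @^-1` B)]fineK ?fin_num_measure//.
(* Both sides, as functions of [A], are finite measures. *)
change (mrestr P mE A = mscale (NngNum PE0) P A).
apply: (g_sigma_algebra_measure_unique Pi _ (fun=> setT)) => //.
- by move=> _ [B1 [C [mB1 mC ->]]]; exact: mcyl.
- by rewrite bigcup_const.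
- move=> _ [B1 [C [mB1 mC ->]]].
  rewrite /= /mscale/= fineK ?fin_num_measure//.
  pose D := \bigcap_(i in [set i | (2 <= i <= k)%N]) eps i @^-1` C i.
  have sX1 : g_sigma_algebra_preimage (X 1%N) (X 1%N @^-1` B1).
    by exists B1 => //; rewrite setTI.
  have sD : sigma_family [set i | (2 <= i)%N] eps D.
    by apply: sfam => // i /andP[].
  pose J := [fset i in iota 2 k.-1]%fset.
  have inJ i : (i \in J) = (2 <= i <= k)%N.
    by rewrite in_fset/= mem_iota; lia.
  pose C' i := if i == k.+1 then B else C i.
  have C'E i : (2 <= i <= k)%N -> C' i = C i.
    by rewrite /C'; case: eqP => // ->; rewrite ltnn andbF.
  have DE : D = \bigcap_(i in [set` J]) eps i @^-1` C i.
    by apply/seteqP; split => w Dw i; have := Dw i; rewrite /= inJ; exact.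
  have DEE : D `&` E = \bigcap_(i in [set` (k.+1 |` J)%fset]) eps i @^-1` C' i.
    apply/seteqP; split => [w [Dw Ew] i /=|w Dw].
      rewrite in_fset1U => /orP[/eqP ->|]; first by rewrite /C' eqxx.
      by rewrite inJ => ik; rewrite C'E//; exact: Dw.
    split; last by have := Dw k.+1; rewrite /= in_fset1U eqxx /C' eqxx; exact.
    move=> i ik; have := Dw i.
    rewrite /= in_fset1U inJ [(2 <= i <= k)%N]ik orbT C'E//.
    exact.
  have mC' i : measurable (C' i) by rewrite /C'; case: ifPn.
  have k1J2 i : i \in (k.+1 |` J)%fset -> (2 <= i)%N.
    by rewrite in_fset1U => /orP[/eqP ->//|]; rewrite inJ => /andP[].
  have sDE : sigma_family [set i | (2 <= i)%N] eps (D `&` E).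
    by rewrite DEE; apply: sfam => // i /k1J2.
  rewrite /mrestr /cyl -/D -setIA.
  rewrite (X1_eps _ _ sX1 sDE) (X1_eps _ _ sX1 sD) [RHS]muleCA; congr (_ * _)%E.
  rewrite DEE eps_indep//; last by move=> i /k1J2 /ltnW.
  rewrite big_fsetU1/=; last by rewrite inJ ltnn andbF.
  rewrite [C' k.+1]/C' eqxx; congr (_ * _)%E.
  rewrite DE eps_indep//; last first.
    by move=> i /=; rewrite inJ => /andP[/ltnW].
  by apply: eq_big_seq => i; rewrite inJ => /C'E ->.
- move=> i; have PTE := probability_le1 P (measurableI _ _ measurableT mE).
  exact: le_lt_trans PTE (ltry 1).
Qed.

(** * Distances between trajectories *)

Section weighted_distance.
Context (R : realType) (M : completePMetricType R).

(** The last coordinate has a weight of its own, because it is the only one on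
    which the later innovations act. *)
Definition wdist (c : R) (k : nat) (x x' : k.+1.-tuple M) : R :=
  \sum_(i < k.+1 | i != ord_max) mdist (tnth x i) (tnth x' i) +
  c * mdist (tnth x ord_max) (tnth x' ord_max).

Lemma tnth_rcons_widen (k : nat) (x : k.-tuple M) (a : M) (i : 'I_k) :
  tnth [tuple of rcons x a] (widen_ord (leqnSn k) i) = tnth x i.
Proof. by rewrite !(tnth_nth point)/= nth_rcons size_tuple ltn_ord. Qed.

Lemma tnth_rcons_last (k : nat) (x : k.-tuple M) (a : M) :
  tnth [tuple of rcons x a] ord_max = a.
Proof. by rewrite (tnth_nth point)/= nth_rcons size_tuple ltnn eqxx. Qed.

Lemma sum_mdistE (k : nat) (x x' : k.+1.-tuple M) :
  \sum_(i < k.+1) mdist (tnth x i) (tnth x' i) = wdist 1 x x'.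
Proof. by rewrite (bigD1 ord_max)//= addrC /wdist mul1r. Qed.

Lemma wdist_rcons (c : R) (k : nat) (x x' : k.-tuple M) (a a' : M) :
  wdist c [tuple of rcons x a] [tuple of rcons x' a'] =
  \sum_(i < k) mdist (tnth x i) (tnth x' i) + c * mdist a a'.
Proof.
rewrite /wdist !tnth_rcons_last; congr (_ + _).
rewrite big_mkcond big_ord_recr/= eqxx addr0; apply: eq_bigr => i _.
by rewrite !tnth_rcons_widen ifT// -val_eqE/= ltn_eqF.
Qed.

Lemma wdist_le (c : R) (k : nat) (x x' : k.+1.-tuple M) : 1 <= c ->
  wdist c x x' <= c * \sum_(i < k.+1) mdist (tnth x i) (tnth x' i).
Proof.
move=> c1; rewrite sum_mdistE /wdist mul1r mulrDr lerD2r.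
by rewrite ler_peMl// sumr_ge0// => i _; exact: mdist_ge0.
Qed.

Lemma wdist_separate (c : R) (k : nat) (h : k.+1.-tuple M -> R) : 1 <= c ->
  (forall x x', `|h x - h x'| <= wdist c x x') -> separately_lipschitz h.
Proof.
move=> c1 hlip i; exists c => x x' xx'; apply: le_trans (hlip x x') _.
apply: le_trans (wdist_le _ _ c1) _.
rewrite (bigD1 i)//= big1 ?addr0// => j ji.
by rewrite xx'// mdistxx.
Qed.

End weighted_distance.

Lemma Kfun0 (R : realType) (rho : R) : rho < 1 -> Kfun rho 0 = 1.
Proof. by move=> r1; rewrite /Kfun expr1 divff// subr_eq0 gt_eqF. Qed.

Lemma KfunS (R : realType) (rho : R) (k : nat) : rho < 1 ->
  Kfun rho k.+1 = 1 + rho * Kfun rho k.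
Proof.
move=> r1; have r0 : 1 - rho != 0 by rewrite subr_eq0 gt_eqF.
by rewrite /Kfun exprS; field.
Qed.

Lemma Kfun_ge1 (R : realType) (rho : R) (k : nat) : 0 <= rho -> rho < 1 ->
  1 <= Kfun rho k.
Proof.
move=> r0 r1; elim: k => [|k ih]; first by rewrite Kfun0.
by rewrite KfunS// lerDl mulr_ge0// (le_trans ler01).
Qed.

(** * Integrating out the last coordinate of a Lipschitz function *)

Section one_step.
Context (R : realType) (M N : completePMetricType R) (F : M -> N -> M)
  (m : probability (borel N) R).
Hypothesis sepM : separable M.
Hypothesis mF : measurable_fun setT
  (fun p : borel M * borel N => F p.1 p.2 : borel M).

Definition extend (k : nat) (x : k.+1.-tuple M) (y : N) : k.+2.-tuple M :=
  [tuple of rcons x (F (tnth x ord_max) y)].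

Definition integrate_last (k : nat) (h : k.+2.-tuple M -> R)
    (x : k.+1.-tuple M) : R :=
  \int[m]_y h (extend x y).

(** The distance is a Lipschitz function of a pair of points. *)
Lemma measurable_mdist2 (d : measure_display) (T : measurableType d)
  (u v : T -> M) :
  measurable_fun setT (u : T -> borel M) ->
  measurable_fun setT (v : T -> borel M) ->
  measurable_fun setT (fun t => mdist (u t) (v t)).
Proof.
move=> mu mv; pose i1 : 'I_2 := ord_max.
apply: (measurable_lipschitz_tuple sepM
  (h := fun x : 2.-tuple M => mdist (tnth x ord0) (tnth x i1))
  (c := 1) (U := fun t => [tuple u t; v t])) => //.
- move=> x x'; rewrite mul1r big_ord_recr big_ord1/=.
  rewrite (_ : widen_ord _ _ = ord0); last exact/val_inj.
  rewrite -/i1.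
  move: (tnth x _) (tnth x i1) (tnth x' _) (tnth x' i1) => a b a' b'.
  (* Each endpoint is moved in turn, in both directions. *)
  have := metric_triangle a a' b; have := metric_triangle a' b' b.
  have := metric_triangle a' a b'; have := metric_triangle a b b'.
  rewrite (metric_sym a' a) (metric_sym b' b) ler_norml; lra.
- by case=> -[|[|//]] ?.
Qed.

Lemma measurable_section (x : M) :
  measurable_fun setT (F x : borel N -> borel M).
Proof. exact: measurable_comp mF (measurable_fun_pair _ _). Qed.

Context (rho : R).
Hypothesis contr : forall x x' : M,
  (\int[m]_y (mdist (F x y) (F x' y))%:E <= (rho * mdist x x')%:E)%E.

Lemma integrable_mdist_section (x x' : M) :
  m.-integrable setT (fun y => (mdist (F x y) (F x' y))%:E).
Proof.
apply/integrableP; split.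
  apply/measurable_EFinP; apply: measurable_mdist2; exact: measurable_section.
under eq_integral do rewrite gee0_abs ?lee_fin ?mdist_ge0//.
exact: le_lt_trans (contr x x') (ltry _).
Qed.

Context (k : nat) (h : k.+2.-tuple M -> R) (c : R).
Hypothesis c1 : 1 <= c.
Hypothesis hlip : forall x x', `|h x - h x'| <= wdist c x x'.

Lemma measurable_wlip (d : measure_display) (T : measurableType d)
    (U : T -> k.+2.-tuple M) :
  (forall i, measurable_fun setT (fun t => tnth (U t) i : borel M)) ->
  measurable_fun setT (h \o U).
Proof.
apply: (measurable_lipschitz_tuple sepM (c := c)) => [|x x'].
  exact: le_trans c1.
exact: le_trans (hlip x x') (wdist_le _ _ c1).
Qed.

Lemma measurable_extend (d : measure_display) (T : measurableType d)
    (U : T -> k.+1.-tuple M) (V : T -> borel N) :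
  (forall i, measurable_fun setT (fun t => tnth (U t) i : borel M)) ->
  measurable_fun setT V ->
  measurable_fun setT (fun t => h (extend (U t) (V t))).
Proof.
move=> mU mV; apply: measurable_wlip => i.
have [->|ik] := eqVneq i ord_max.
  under eq_fun do rewrite tnth_rcons_last.
  exact: (measurableT_comp mF (measurable_fun_pair (mU ord_max) mV)).
have {}ik : (i < k.+1)%N.
  by rewrite ltn_neqAle -ltnS ltn_ord andbT.
rewrite (_ : i = widen_ord (leqnSn _) (Ordinal ik)); last exact/val_inj.
under eq_fun do rewrite tnth_rcons_widen.
exact: mU.
Qed.

Lemma extend_lip (x x' : k.+1.-tuple M) (y y' : N) :
  `|h (extend x y) - h (extend x' y')| <=
  \sum_(i < k.+1) mdist (tnth x i) (tnth x' i) +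
  c * mdist (F (tnth x ord_max) y) (F (tnth x' ord_max) y').
Proof. by rewrite -wdist_rcons; exact: hlip. Qed.

Hypothesis ex_integrable :
  exists x, m.-integrable setT (fun y => (h (extend x y))%:E).

(** For two arguments [x] and [x0], the integrands differ by at most a constant
    plus [c] times a distance that the contraction property makes integrable. *)
Lemma integrable_extend (x : k.+1.-tuple M) :
  m.-integrable setT (fun y => (h (extend x y))%:E).
Proof.
have [x0 ix0] := ex_integrable.
pose s := \sum_(i < k.+1) mdist (tnth x i) (tnth x0 i).
have is_ : m.-integrable setT (fun y =>
    (s + c * mdist (F (tnth x ord_max) y) (F (tnth x0 ord_max) y))%:E).
  exact: (integrableD measurableT
    (finite_measure_integrable_cst m s measurableT)
    (integrableZl measurableT c (integrable_mdist_section _ _))).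
have mh : measurable_fun setT (fun y : borel N => h (extend x y)).
  by apply: measurable_extend.
have id_ : m.-integrable setT (fun y =>
    (h (extend x y))%:E - (h (extend x0 y))%:E)%E.
  apply: le_integrable is_ => //.
    apply: emeasurable_funB; first exact/measurable_EFinP.
    exact: measurable_int ix0.
  move=> y _; rewrite -EFinB !abse_EFin lee_fin.
  by rewrite (le_trans _ (ler_norm _))// extend_lip.
apply: eq_integrable (integrableD measurableT id_ ix0) => // y _ /=.
by rewrite -EFinD subrK.
Qed.

(** The weight [1 + rho * c] collects the two ways in which the last coordinate
    of [x] enters: directly, and through the coordinate that is appended. *)
Lemma integrate_last_lip (x x' : k.+1.-tuple M) :
  `|integrate_last h x - integrate_last h x'| <= wdist (1 + rho * c) x x'.
Proof.
pose s := \sum_(i < k.+1) mdist (tnth x i) (tnth x' i).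
pose dF y := mdist (F (tnth x ord_max) y) (F (tnth x' ord_max) y).
have mdF : measurable_fun setT (dF : borel N -> R).
  by apply: measurable_mdist2; exact: measurable_section.
have c0 : 0 <= c by exact: le_trans c1.
rewrite -lee_fin /integrate_last; apply: le_trans.
  apply: (abs_Rintegral_sub_le (mu := m) (u := fun y => h (extend x y))
    (v := fun y => h (extend x' y)) (c := fun y => s + c * dF y)).
  - exact: integrable_extend.
  - exact: integrable_extend.
  - by apply: measurable_funD => //; exact: measurable_funM.
  - by move=> y; exact: extend_lip.
under eq_integral do rewrite EFinD EFinM.
rewrite ge0_integralD//=; first last.
- by apply: emeasurable_funM => //; exact/measurable_EFinP.
- by move=> y _; rewrite mule_ge0// lee_fin mdist_ge0.
- by move=> y _; rewrite lee_fin sumr_ge0// => i _; exact: mdist_ge0.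
rewrite integral_cst// [X in (_ * X + _)%E](probability_setT m) mule1.
rewrite ge0_integralZl_EFin//; first last.
- exact/measurable_EFinP.
- by move=> y _; rewrite lee_fin mdist_ge0.
apply: le_trans (leeD2l _ (lee_wpmul2l _ (contr _ _))) _ => //.
rewrite -EFinM -EFinD lee_fin /s sum_mdistE /wdist.
by rewrite mulrDl mulrCA mulrA addrA.
Qed.

End one_step.

(** * Conditional expectations along the chain *)

Lemma sigma_set0 (T : Type) (A : set T) :
  <<s set0 >> A -> A = set0 \/ A = setT.
Proof.
suff : <<s set0 >> `<=` [set B : set T | B = set0 \/ B = setT] by apply.
apply: smallest_sub => //; split => [|B|G]; first by left.
- by rewrite setTD => -[->|->]; [right; rewrite setC0|left; rewrite setCT].
- move=> GT; have [[i Gi]|nG] := pselect (exists i, G i = setT).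
    by right; apply/seteqP; split => // x _; exists i => //; rewrite Gi.
  left; apply/seteqP; split => // x [i _]; case: (GT i) => [->//|Gi].
  by case: nG; exists i.
Qed.

Lemma is_cond_exp_trivial (R : realType) (d : measure_display)
  (Om : measurableType d) (P : probability Om R) (f : Om -> R) (c : R) :
  P.-integrable setT (EFin \o f) -> c = fine (\int[P]_w (f w)%:E)%E ->
  is_cond_exp P <<s set0 >> f (cst c).
Proof.
move=> fi cE; split.
- move=> B _; have [cB|cB] := pselect (B c).
    rewrite (_ : _ @^-1` _ = setT); last by apply/seteqP; split.
    exact: (@measurableT _ (g_sigma_algebraType (set0 : set (set Om)))).
  rewrite (_ : _ @^-1` _ = set0); last by apply/seteqP; split.
  exact: (@measurable0 _ (g_sigma_algebraType (set0 : set (set Om)))).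
- exact: finite_measure_integrable_cst.
- move=> A /sigma_set0[->|->]; first by rewrite !integral_set0.
  have -> : (\int[P]_w (cst c w)%:E = c%:E * P setT)%E.
    exact: (integral_cst P measurableT c%:E).
  rewrite [X in (_ * X)%E](probability_setT P) mule1 cE fineK//.
  exact: integrable_fin_num.
Qed.

Lemma innovation_law (R : realType) (N : completePMetricType R)
  (d : measure_display) (Om : measurableType d) (P : probability Om R)
  (eps : nat -> {RV P >-> borel N}) (k : nat) (B : set (borel N)) :
  identically_distributed [set i | (1 <= i)%N] eps -> measurable B ->
  P (eps k.+1 @^-1` B) = distribution P (eps 1%N) B.
Proof. by move=> eps_id mB; rewrite (eps_id 1%N k.+1). Qed.

Section chain_step.
Context (R : realType) (M N : completePMetricType R) (sepM : separable M)
  (d : measure_display) (Om : measurableType d) (P : probability Om R)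
  (eps : nat -> {RV P >-> borel N}) (X : nat -> {RV P >-> borel M})
  (F : M -> N -> M).
Hypothesis eps_iid : iid [set i | (1 <= i)%N] eps.
Hypothesis X1_eps : independent_systems P (g_sigma_algebra_preimage (X 1%N))
  (sigma_family [set i | (2 <= i)%N] eps).
Hypothesis mF : measurable_fun setT
  (fun p : borel M * borel N => F p.1 p.2 : borel M).
Hypothesis chain : forall i w, (2 <= i)%N -> X i w = F (X i.-1 w) (eps i w).
Context (rho : R) (rho_ge0 : 0 <= rho).
Let m : probability (borel N) R := distribution P (eps 1%N).
Hypothesis contr : forall x x' : M,
  (\int[m]_y (mdist (F x y) (F x' y))%:E <= (rho * mdist x x')%:E)%E.

Let past k := sigma_family [set i | (1 <= i <= k)%N] X.
(** The identity of [Om], seen as a random variable with values in [pastT k],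
    stands for the trajectory: it generates exactly the past, so that no
    sigma-algebra on tuples is needed. *)
Let pastT k := g_sigma_algebraType
  (\bigcup_(i in [set i | (1 <= i <= k)%N]) g_sigma_algebra_preimage (X i)).

Lemma past_measurable k A : past k A -> measurable A.
Proof.
apply: smallest_sub; first exact: sigma_algebra_measurable.
by move=> _ [i _ [B mB <-]]; rewrite setTI; exact: measurable_funPTI.
Qed.

Lemma sub_past k A : past k A -> past k.+1 A.
Proof.
apply: sub_smallest2r; first exact: smallest_sigma_algebra.
by move=> B [i /= /andP[i1 ik] Bi]; exists i => //=; rewrite i1 ltnW.
Qed.

Lemma measurable_traj k (i : 'I_k) :
  measurable_fun setT (fun w : pastT k => tnth (traj X k w) i : borel M).
Proof.
move=> _ B mB; rewrite setTI; apply: sub_sigma_algebra; exists i.+1 => /=.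
  exact: ltn_ord.
exists B => //; rewrite setTI; apply/funext => w.
by rewrite /preimage/= tnth_mktuple.
Qed.

Lemma traj_extend k w :
  traj X k.+2 w = extend F (traj X k.+1 w) (eps k.+2 w).
Proof.
apply: eq_from_tnth => i; rewrite tnth_mktuple.
have [->|ik] := eqVneq i ord_max.
  by rewrite tnth_rcons_last tnth_mktuple chain.
have {}ik : (i < k.+1)%N by rewrite ltn_neqAle -ltnS ltn_ord andbT.
rewrite (_ : i = widen_ord (leqnSn _) (Ordinal ik)); last exact/val_inj.
by rewrite tnth_rcons_widen tnth_mktuple.
Qed.

Context (k : nat) (h : k.+2.-tuple M -> R) (c : R) (f : Om -> R).
Hypothesis c1 : 1 <= c.
Hypothesis hlip : forall x x', `|h x - h x'| <= wdist c x x'.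
Hypothesis hcond : is_cond_exp P (past k.+2) f (h \o traj X k.+2).

Let phi (p : pastT k.+1 * borel N) : R := h (extend F (traj X k.+1 p.1) p.2).

Let mphi : measurable_fun setT phi.
Proof.
apply: (measurable_extend sepM mF c1 hlip) => //= i.
exact: (measurableT_comp (@measurable_traj k.+1 i) measurable_fst).
Qed.

Let mid : measurable_fun setT (id : Om -> pastT k.+1).
Proof. by move=> _ A pA; rewrite setTI; exact: past_measurable pA. Qed.

Let indep (A : set (pastT k.+1)) (B : set (borel N)) :
  measurable A -> measurable B ->
  P ((id : Om -> pastT k.+1) @^-1` A `&` eps k.+2 @^-1` B) =
  (P ((id : Om -> pastT k.+1) @^-1` A) * m B)%E.
Proof.
move=> pA mB; case: eps_iid => eps_ind eps_id.
rewrite (indep_past_innovation eps_ind X1_eps mF chain)//.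
by rewrite (innovation_law _ eps_id).
Qed.

Let iphi : P.-integrable setT (fun w => (phi (w, eps k.+2 w))%:E).
Proof.
case: hcond => _ + _; apply: eq_integrable => // w _ /=.
by rewrite traj_extend.
Qed.

Lemma ex_integrable_extend :
  exists x, m.-integrable setT (fun y => (h (extend F x y))%:E).
Proof.
have [w iw] := ex_integrable_section mid (measurable_funP _) indep mphi iphi.
by exists (traj X k.+1 w).
Qed.

Let ih := integrable_extend sepM mF contr c1 hlip ex_integrable_extend.

Lemma chain_step_lip (x x' : k.+1.-tuple M) :
  `|integrate_last F m h x - integrate_last F m h x'| <=
  wdist (1 + rho * c) x x'.
Proof. exact: integrate_last_lip ex_integrable_extend _ _. Qed.

(** By the freezing lemma, averaging [h] over the last innovation preserves the
    integrals over the events of [past k.+1]; these events belong to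
    [past k.+2], where [h] along the trajectory already has the integrals of
    [f]. *)
Lemma chain_step_cond_exp :
  is_cond_exp P (past k.+1) f (integrate_last F m h \o traj X k.+1).
Proof.
have EI w : ((integrate_last F m h (traj X k.+1 w))%:E =
    \int[m]_v (phi (w, v))%:E)%E.
  by rewrite /integrate_last /Rintegral fineK// integrable_fin_num.
case: hcond => _ _ hA; split.
- move=> B mB; rewrite -[X in past _ X]setTI.
  have rc1 : 1 <= 1 + rho * c by rewrite lerDl mulr_ge0// (le_trans ler01).
  have c0 : 0 <= 1 + rho * c by exact: le_trans rc1.
  apply: (measurable_lipschitz_tuple sepM (T := pastT k.+1) c0) => //.
    by move=> x x'; exact: le_trans (chain_step_lip x x') (wdist_le _ _ rc1).
  exact: measurable_traj.
- apply: eq_integrable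
    (integrable_freezing mid (measurable_funP _) indep mphi iphi) => //.
  by move=> w _; rewrite /= EI.
- move=> A pA; rewrite -hA; last exact: sub_past.
  under eq_integral do rewrite EI.
  have := integral_freezing mid (measurable_funP _) indep mphi iphi pA.
  rewrite preimage_id => ->.
  by apply: eq_integral => w _; rewrite /= traj_extend.
Qed.

End chain_step.

(** * Lipschitz versions and martingale differences *)

Theorem proposition2p1 (R : realType) (M N : completePMetricType R)
  (sepM : separable M) (sepN : separable N)
  (d : measure_display) (Om : measurableType d) (P : probability Om R)
  (eps : nat -> {RV P >-> borel N}) (X : nat -> {RV P >-> borel M})
  (F : M -> N -> M)
  (eps_iid : iid [set i | (1 <= i)%N] eps)
  (X1_eps : independent_systems P (g_sigma_algebra_preimage (X 1%N))
     (sigma_family [set i | (2 <= i)%N] eps))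
  (mF : measurable_fun setT
     (fun p : borel M * borel N => F p.1 p.2 : borel M))
  (chain : forall i w, (2 <= i)%N -> X i w = F (X i.-1 w) (eps i w))
  (rho : R) (rho_ge0 : 0 <= rho) (rho_lt1 : rho < 1)
  (contr : forall x x' : M,
     ('E_P[fun w => mdist (F x (eps 1%N w)) (F x' (eps 1%N w))]
      <= (rho * mdist x x')%:E)%E)
  (n : nat) (n_ge1 : (1 <= n)%N) (f : n.-tuple M -> R)
  (f_lip : forall x x' : n.-tuple M,
     `|f x - f x'| <= \sum_(i < n) mdist (tnth x i) (tnth x' i))
  (f_int : P.-integrable setT (EFin \o (f \o traj X n)))
  (g : forall k, k.-tuple M -> R)
  (g_def : backward_version X eps F f g) :
  [/\ forall k, (k <= n)%N ->
        is_cond_exp P (sigma_family [set i | (1 <= i <= k)%N] X)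
          (f \o traj X n) (g k \o traj X k),
      forall k, (k < n)%N ->
        separately_lipschitz (g k.+1) /\
        forall x x' : k.+1.-tuple M,
          `|g k.+1 x - g k.+1 x'| <=
            \sum_(i < k.+1 | i != ord_max) mdist (tnth x i) (tnth x' i)
            + Kfun rho (n - k.+1) * mdist (tnth x ord_max) (tnth x' ord_max),
      {ae P, forall w, (`|mart_diff X g 1 w|%:E
          <= (Kfun rho (n - 1))%:E * G_X1 (X 1%N) (X 1%N w))%E} /\
      (forall k, (2 <= k <= n)%N ->
        {ae P, forall w, (`|mart_diff X g k w|%:E
          <= (Kfun rho (n - k))%:E *
             H_eps (eps 1%N) F (X k.-1 w) (eps k w))%E}) &
      forall C : R, 0 < C ->
        (forall (x : M) (y y' : N), mdist (F x y) (F x y') <= C * mdist y y') ->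
        (forall (x : M) (y : N),
          (H_eps (eps 1%N) F x y <= G_eps (eps 1%N) C y)%E) /\
        (forall k, (2 <= k <= n)%N ->
          {ae P, forall w, (`|mart_diff X g k w|%:E
            <= (Kfun rho (n - k))%:E * G_eps (eps 1%N) C (eps k w))%E})].
Proof.
have eps_id := eps_iid.2.
pose m : probability (borel N) R := distribution P (eps 1%N).
have contr' (x x' : M) :
    (\int[m]_y (mdist (F x y) (F x' y))%:E <= (rho * mdist x x')%:E)%E.
  apply: le_trans (contr x x'); rewrite unlock ge0_integral_distribution//.
    apply/measurable_EFinP; apply: (measurable_mdist2 sepM) => //;
    exact: measurable_section.
  by move=> y; rewrite lee_fin mdist_ge0.
case: n n_ge1 f f_lip f_int g_def => // n' _ f' f'_lip f'_int [gn gS g0].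
(* Backward induction on [k]: [j] innovations have been integrated out. *)
have main j : forall k, (k + j = n')%N ->
    (forall x x', `|g k.+1 x - g k.+1 x'| <= wdist (Kfun rho j) x x') /\
    is_cond_exp P (sigma_family [set i | (1 <= i <= k.+1)%N] X)
      (f' \o traj X n'.+1) (g k.+1 \o traj X k.+1).
  elim: j => [k|j ih k].
    rewrite addn0 => ->; rewrite gn Kfun0//; split.
      by move=> x x'; rewrite -sum_mdistE; exact: f'_lip.
    split => // B mB; rewrite -[X in sigma_family _ _ X]setTI.
    apply: (measurable_lipschitz_tuple sepM (T := g_sigma_algebraType _)
      (c := 1)) => //.
      by move=> x x'; rewrite mul1r; exact: f'_lip.
    exact: measurable_traj.
  rewrite addnS -addSn => kj; have [hlip hcond] := ih _ kj.
  have K1 := Kfun_ge1 j rho_ge0 rho_lt1.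
  have -> : g k.+1 = integrate_last F m (g k.+2).
    by apply/funext => x; rewrite gS//; lia.
  rewrite KfunS//; split.
    move=> x x'.
    exact: (chain_step_lip sepM eps_iid X1_eps mF chain contr' K1 hlip hcond).
  exact: (chain_step_cond_exp sepM eps_iid X1_eps mF chain rho_ge0 contr' K1
    hlip hcond).
have glip k : (k < n'.+1)%N ->
    forall x x', `|g k.+1 x - g k.+1 x'| <=
      wdist (Kfun rho (n'.+1 - k.+1)) x x'.
  by move=> kn; have [] := main (n'.+1 - k.+1)%N k; first lia.
have gcond k : (k < n'.+1)%N ->
    is_cond_exp P (sigma_family [set i | (1 <= i <= k.+1)%N] X)
      (f' \o traj X n'.+1) (g k.+1 \o traj X k.+1).
  by move=> kn; have [] := main (n'.+1 - k.+1)%N k; first lia.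
have K1 j := Kfun_ge1 j rho_ge0 rho_lt1.
have K0 j : 0 <= Kfun rho j by exact: le_trans (K1 j).
(* Both arguments of [g k.+2] extend the same trajectory, so that only the
   appended coordinate contributes to their distance. *)
have diffS k w : (k.+1 < n'.+1)%N -> (`|mart_diff X g k.+2 w|%:E <=
    (Kfun rho (n'.+1 - k.+2))%:E * H_eps (eps 1%N) F (X k.+1 w) (eps k.+2 w))%E.
  move=> kn; have hlip := glip _ kn.
  rewrite /mart_diff /= (traj_extend chain) (gS k)//.
  have Xk : X k.+1 w = tnth (traj X k.+1 w) ord_max by rewrite tnth_mktuple.
  apply: abs_sub_Rintegral_le => //.
  - by move=> y; exact: mdist_ge0.
  - apply: (integrable_extend sepM mF contr' (K1 _) hlip).
    exact: (ex_integrable_extend sepM eps_iid X1_eps mF chain (K1 _) hlip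
      (gcond _ kn)).
  - apply: (measurable_mdist2 sepM); first exact: measurable_cst.
    exact: measurable_section.
  - move=> y; rewrite Xk.
    have := extend_lip F hlip (traj X k.+1 w) (traj X k.+1 w) (eps k.+2 w) y.
    by rewrite big1 ?add0r// => i _; rewrite mdistxx.
split.
- case=> [_|k]; last exact: gcond.
  have -> : g 0%N \o traj X 0 = cst (fine 'E_P[f' \o traj X n'.+1]).
    by apply/funext => w; rewrite /= g0.
  rewrite /sigma_family (_ : bigcup _ _ = set0).
    by apply: is_cond_exp_trivial => //; rewrite unlock.
  by rewrite bigcup0// => i /= /andP[i1 i0]; lia.
- move=> k kn; split; last exact: glip.
  exact: (wdist_separate (K1 _) (glip _ kn)).
- split.
    apply/aeW => w.
    have gX1 : (g 1%N \o traj X 1) = (fun x : M => g 1%N [tuple x]) \o X 1%N.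
      by apply/funext => v; congr (g 1%N _); apply: eq_from_tnth => i;
        rewrite tnth_mktuple [i]ord1.
    have mg1 : measurable_fun setT (fun x : borel M => g 1%N [tuple (x : M)]).
      apply: (measurable_lipschitz_tuple sepM (K0 _)
        (U := fun x : borel M => [tuple (x : M)])).
        by move=> x x'; exact: le_trans (glip 0%N _ x x') (wdist_le _ _ (K1 _)).
      by move=> i; rewrite [i]ord1; exact: measurable_id.
    have [_ ig1 g1E] := gcond 0%N isT.
    have ig1' : (distribution P (X 1%N)).-integrable setT
        (fun x => (g 1%N [tuple (x : M)])%:E).
      apply: integrable_pushforward => //; first exact/measurable_EFinP.
      by rewrite gX1 in ig1; exact: ig1.
    (* [g 0] is the mean of [g 1 (X 1)], that is the average of [g 1] over the
       law of [X 1]. *)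
    have Ef : (\int[P]_v ((f' \o traj X n'.+1) v)%:E =
        \int[distribution P (X 1%N)]_x (g 1%N [tuple (x : M)])%:E)%E.
      rewrite integral_distribution; last 2 first.
      - exact/measurable_EFinP.
      - by rewrite gX1 in ig1; exact: ig1.
      rewrite -g1E; last exact: (@measurableT _ (g_sigma_algebraType _)).
      by rewrite gX1.
    rewrite /mart_diff /= g0 unlock Ef.
    have -> : traj X 1 w = [tuple X 1%N w].
      by apply: eq_from_tnth => i; rewrite tnth_mktuple [i]ord1.
    apply: abs_sub_Rintegral_le => //.
    - by move=> y; exact: mdist_ge0.
    - apply: (measurable_mdist2 sepM); first exact: measurable_cst.
      exact: measurable_id.
    - move=> x; apply: le_trans (glip 0%N _ _ _) _ => //.
      rewrite /wdist big1 ?add0r// => i; last by rewrite [i]ord1.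
  move=> [//|[//|k]] /andP[_ kn]; apply/aeW => w; exact: diffS.
- move=> C C0 FC.
  have HG x y : (H_eps (eps 1%N) F x y <= G_eps (eps 1%N) C y)%E.
    apply: ge0_le_integral => //.
    - by move=> y' _; rewrite lee_fin mdist_ge0.
    - apply/measurable_EFinP; apply: (measurable_mdist2 sepM).
        exact: measurable_cst.
      exact: measurable_section.
    - apply/measurable_EFinP; apply: measurable_funM => //.
      apply: (measurable_mdist2 sepN); first exact: measurable_cst.
      exact: measurable_id.
    - by move=> y' _; rewrite lee_fin FC.
  split=> // -[//|[//|k]] /andP[_ kn]; apply/aeW => w.
  apply: le_trans (diffS _ _ kn) _; apply: lee_wpmul2l => //.
  by rewrite lee_fin.
Qed.
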